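(* Let $X$ be a Tychonoff space. (a) If $X$ has a $\sigma$-disjoint base consisting of cozero-sets, then $X$ can be embedded in a uniform Eberlein compact. (b) If $X$ has a $\sigma$-strongly point-finite base consisting of cozero-sets, then $X$ can be embedded in an Eberlein compact.
   Context: A cozero-set of $X$ is a set $X\setminus f^{-1}(0)$ for a continuous $f:X\to[0,1]$. A family of subsets of a set is strongly point-finite if every countably infinite subfamily contains a finite subfamily with empty intersection; $\sigma$-strongly point-finite means a countable union of such families. An Eberlein compact is a compact Hausdorff space homeomorphic to a weakly compact subset of a Banach space; a uniform Eberlein compact is one homeomorphic to a weakly compact subset of a Hilbert space. *)

(* Defs.v *)
From HB Require Import structures.
From mathcomp Require Import all_boot all_order all_algebra.
From mathcomp Require Import all_classical all_reals all_analysis.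
Set Implicit Arguments. Unset Strict Implicit. Unset Printing Implicit Defensive.
Import Order.TTheory GRing.Theory Num.Theory.
Import numFieldNormedType.Exports.
Local Open Scope classical_set_scope.
Local Open Scope ring_scope.

Definition completely_regular (R : realType) (X : topologicalType) :=
  forall (a : X) (B : set X), closed B -> ~ B a ->
    exists f : X -> R, [/\ continuous f, (forall x, 0 <= f x <= 1),
                           f a = 0 & (forall x, B x -> f x = 1)].

Definition tychonoff_space (R : realType) (X : topologicalType) :=
  hausdorff_space X /\ completely_regular R X.

Definition cozero_set (R : realType) (X : topologicalType) (A : set X) :=
  exists f : X -> R, [/\ continuous f, (forall x, 0 <= f x <= 1) &
                         A = ~` (f @^-1` [set 0])].

Definition disjoint_family (T : Type) (F : set (set T)) :=
  forall A B, F A -> F B -> A <> B -> A `&` B = set0.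

Definition sigma_disjoint (T : Type) (F : set (set T)) :=
  exists G : nat -> set (set T), F = \bigcup_n G n /\ forall n, disjoint_family (G n).

Definition strongly_point_finite (T : Type) (F : set (set T)) :=
  forall S : set (set T), S `<=` F -> countable S -> infinite_set S ->
    exists S' : set (set T), [/\ finite_set S', S' `<=` S &
                                 \bigcap_(A in S') A = set0].

Definition sigma_strongly_point_finite (T : Type) (F : set (set T)) :=
  exists G : nat -> set (set T),
    F = \bigcup_n G n /\ forall n, strongly_point_finite (G n).

Definition lin_functional (R : realType) (V : normedModType R) (phi : V -> R) :=
  forall (a : R) (x y : V), phi (a *: x + y) = a * phi x + phi y.

Definition weak_topology (R : realType) (V : normedModType R) : Type := V.

Definition weak_subbase (R : realType) (V : normedModType R) : set (set V) :=
  [set A | exists (phi : V -> R) (U : set R),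
     [/\ lin_functional phi, continuous phi, open U & A = phi @^-1` U]].

Section WeakTop.
Variables (R : realType) (V : normedModType R).
HB.instance Definition _ := Choice.on (weak_topology V).
HB.instance Definition _ :=
  isSubBaseTopological.Build (weak_topology V) (@weak_subbase R V) id.
End WeakTop.

Definition inner_product_for (R : realType) (V : normedModType R)
    (ip : V -> V -> R) :=
  [/\ forall x y, ip x y = ip y x,
      forall (a : R) (x y z : V), ip (a *: x + y) z = a * ip x z + ip y z
    & forall x, `|x| ^+ 2 = ip x x].

Definition top_embedding (X Y : topologicalType) (f : X -> Y) :=
  [/\ injective f, continuous f &
      forall U : set X, open U -> exists W : set Y, open W /\ f @` U = W `&` range f].

Definition embeds_in_Eberlein (R : realType) (X : topologicalType) :=
  exists (V : completeNormedModType R) (K : set (weak_topology V))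
         (f : X -> weak_topology V),
    [/\ compact K, range f `<=` K & top_embedding f].

Definition embeds_in_uniform_Eberlein (R : realType) (X : topologicalType) :=
  exists (V : completeNormedModType R) (ip : V -> V -> R)
         (K : set (weak_topology V)) (f : X -> weak_topology V),
    [/\ inner_product_for ip, compact K, range f `<=` K & top_embedding f].

(* Main.v *)
(* Let B be the union of the families G n, and let f_A be a function with cozero-set
   A.  Map x to (2^-n(A) f_A(x))_A, where n(A) is an index with A in G n(A).  As B
   is a base, this embeds X topologically in a power of R, with image in the compact
   set K of all v with 0 <= v_A <= 2^-n(A) such that every finite subfamily of some
   G n with empty intersection contains an A with v_A = 0.  Strong point-finiteness
   makes each v in K finitely supported on each level, so K lies in c_0(B); if the
   G n are disjoint, v has at most one nonzero coordinate per level, so K lies in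
   l^2(B).  In both cases K is norm bounded, and on bounded sets the weak topology is
   the topology of pointwise convergence, so K is weakly compact. *)
Require Import Defs.
From HB Require Import structures.
From mathcomp Require Import all_boot all_order all_algebra finmap.
From mathcomp Require Import all_classical all_reals all_analysis.
From mathcomp Require Import ring lra.
From mathcomp.analysis.showcase Require Import summability.
Set Implicit Arguments. Unset Strict Implicit. Unset Printing Implicit Defensive.
Import Order.TTheory GRing.Theory Num.Theory.
Import numFieldNormedType.Exports.
Local Open Scope classical_set_scope.
Local Open Scope ring_scope.

Lemma fdisjoint_fsetD (K : choiceType) (A B : {fset K}) : [disjoint A `\` B & B]%fset.
Proof.
rewrite -fsetI_eq0; apply/eqP/fsetP => x.
by rewrite in_fsetI in_fsetD in_fset0; case: (x \in B); rewrite ?andbF.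
Qed.

(** * Finite sums of squares and functions small outside finite sets *)

Section SumSquares.
Variables (R : realType) (I : choiceType).
Implicit Types (F D : {fset I}) (u v w : I -> R).

Definition sumsq F v : R := \sum_(a <- F) v a ^+ 2.

Lemma sumsq_ge0 F v : 0 <= sumsq F v.
Proof. by apply: sumr_ge0 => a _; exact: sqr_ge0. Qed.

Lemma sumsq_split D F v : sumsq F v = sumsq (F `&` D)%fset v + sumsq (F `\` D)%fset v.
Proof.
rewrite /sumsq (big_fsetID _ (mem D)) /=; congr (_ + _).
  by apply: eq_fbigl => a; rewrite !inE.
by apply: eq_fbigl => a; rewrite !inE andbC.
Qed.

Lemma sumsq_sub F D v : (F `<=` D)%fset -> sumsq F v <= sumsq D v.
Proof.
move=> /fsetIidPr FD; rewrite (sumsq_split F D) FD lerDl; exact: sumsq_ge0.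
Qed.

Lemma sumsq_eq0 F v : (forall a, a \in F -> v a = 0) -> sumsq F v = 0.
Proof.
by move=> v0; rewrite /sumsq big_seq big1// => a /v0 ->; rewrite expr0n.
Qed.

Lemma sumsq1 a v : sumsq [fset a]%fset v = v a ^+ 2.
Proof. by rewrite /sumsq big_seq_fset1. Qed.

Lemma sumsqZ F c v : sumsq F (c *: v) = c ^+ 2 * sumsq F v.
Proof. by rewrite /sumsq mulr_sumr; apply: eq_bigr => a _; rewrite exprMn. Qed.

Lemma sumsqB F u v : sumsq F (u - v) = sumsq F (v - u).
Proof. by rewrite -[u - v]opprB -scaleN1r sumsqZ sqrrN expr1n mul1r. Qed.

Lemma sumsqD F u v :
  sumsq F (u + v) = sumsq F u + 2 * (\sum_(a <- F) u a * v a) + sumsq F v.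
Proof.
rewrite /sumsq mulr_sumr -!big_split /=; apply: eq_bigr => a _.
by rewrite -[(u + v) a]/(u a + v a); ring.
Qed.

Lemma sumsqD_le F u v : sumsq F (u + v) <= 2 * (sumsq F u + sumsq F v).
Proof.
rewrite /sumsq -big_split mulr_sumr ler_sum// => a _.
rewrite -[(u + v) a]/(u a + v a) -subr_ge0.
by rewrite (_ : _ - _ = (u a - v a) ^+ 2) ?sqr_ge0//=; ring.
Qed.

(** The sum of squares of [s u - t v] is nonnegative and equals [s (s sumsq F u - t^2)]; divide by
    [s] when it is positive. If [s = 0], then [v] vanishes on [F] and [t = 0]. *)
Lemma cauchy_schwarz F u v :
  (\sum_(a <- F) u a * v a) ^+ 2 <= sumsq F u * sumsq F v.
Proof.
set t := \sum_(a <- _) _; set s := sumsq F v.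
have key : sumsq F (s *: u + (- t) *: v) = s * (s * sumsq F u - t ^+ 2).
  rewrite sumsqD !sumsqZ.
  under eq_bigr do rewrite [X in X * _]/(s * _) [X in _ * X]/((- t) * _) mulrACA.
  rewrite -mulr_sumr -/t -/s; ring.
have [s0|s_neq0] := eqVneq s 0.
  have v0 a : a \in F -> v a = 0.
    move=> aF; apply/eqP; rewrite -sqrf_eq0 eq_le sqr_ge0 andbT -s0 -sumsq1.
    by apply: sumsq_sub; rewrite fsub1set.
  rewrite /t big_seq big1 ?expr0n/= ?mulr_ge0 ?sumsq_ge0//.
  by move=> a /v0 ->; rewrite mulr0.
have s_gt0 : 0 < s by rewrite lt_neqAle eq_sym s_neq0 sumsq_ge0.
rewrite mulrC -subr_ge0 -(pmulr_rge0 _ s_gt0) -key; exact: sumsq_ge0.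
Qed.

(* The norm of [v] will be the supremum of [sqrt (sumsq F v)] over the admissible
   [F]: all finite sets if [b] holds, and otherwise only singletons, for which
   this is the sup norm. *)
Definition admissible (b : bool) F := b || (#|` F| <= 1)%N.

Lemma admissible_sub b F D : (F `<=` D)%fset -> admissible b D -> admissible b F.
Proof.
by move=> /fsubset_leq_card FD /orP[->//|D1]; rewrite /admissible (leq_trans FD) ?orbT.
Qed.

Lemma admissible1 b a : admissible b [fset a]%fset.
Proof. by rewrite /admissible cardfs1 orbT. Qed.

(* Equivalent to: [v] is a norm limit of finitely supported functions. *)
Definition vanishing b v := forall eps, 0 < eps ->
  exists D, forall F, admissible b F -> [disjoint F & D]%fset -> sumsq F v <= eps.

Definition vanishing_pred b : {pred I -> R} := fun v => `[< vanishing b v >].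

Lemma vanishing_submod b : submod_closed (vanishing_pred b).
Proof.
split=> [|c u v /asboolP uV /asboolP vV]; apply/asboolP => eps eps0.
  by exists fset0 => F _ _; rewrite sumsq_eq0// ltW.
(* By [sumsqD_le], the bounds [eps / (4 (c^2 + 1))] for [u] and [eps / 4] for [v] combine to at most
   [eps]; the [+ 1] keeps the divisor positive when [c = 0]. *)
have c0 : 0 < 4 * (c ^+ 2 + 1) by rewrite mulr_gt0// ltr_wpDl ?sqr_ge0.
have [D1 D1P] := uV _ (divr_gt0 eps0 c0).
have [D2 D2P] := vV _ (divr_gt0 eps0 (ltr0n _ 4)).
exists (D1 `|` D2)%fset => F Fb; rewrite fdisjointXU => /andP[FD1 FD2].
apply: le_trans (sumsqD_le _ _ _) _.
rewrite sumsqZ.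
have := D1P _ Fb FD1; have := D2P _ Fb FD2.
rewrite !ler_pdivlMr//; have := sumsq_ge0 F u; have := sqr_ge0 c.
nra.
Qed.

HB.instance Definition _ b := GRing.isSubmodClosed.Build R (I -> R)
  (vanishing_pred b) (vanishing_submod b).

Lemma sumsq_cvg (T : Type) (G : set_system T) (h : T -> I -> R) (l : I -> R) F :
  Filter G -> (forall a, h ^~ a @ G --> l a) -> (fun t => sumsq F (h t)) @ G --> sumsq F l.
Proof.
move=> GF hl; rewrite /sumsq.
apply: cvg_big => [|a _]; last by apply: cvgM; exact: hl.
exact: add_continuous.
Qed.

(** The part of [F] inside [D] contributes at most [sumsq D f], the rest at most 1. This makes the
    supremum in the norm finite. *)
Lemma vanishing_bounded b (f : I -> R) : vanishing b f ->
  exists M, forall F, admissible b F -> sumsq F f <= M.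
Proof.
move=> /(_ _ ltr01)[D DP]; exists (sumsq D f + 1) => F Fb.
rewrite (sumsq_split D) lerD//; first by rewrite sumsq_sub// fsubsetIr.
by apply: DP; [exact: admissible_sub (fsubsetDl _ _) Fb|exact: fdisjoint_fsetD].
Qed.

End SumSquares.

(* This is [l^2(I)] for [b = true] and [c_0(I)] for [b = false]. *)
Record seqspace (R : realType) (I : choiceType) (b : bool) := SeqSpace {
  coordf :> I -> R ; _ : coordf \in vanishing_pred b }.

Section Space.
Variables (R : realType) (I : choiceType) (b : bool).
Local Notation E := (@seqspace R I b).
HB.instance Definition _ := [isSub of E for @coordf R I b].
HB.instance Definition _ := [Choice of E by <:].
HB.instance Definition _ := [SubChoice_isSubLmodule of E by <:].
End Space.

(** * Norm and completeness of the sequence spaces *)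

Section Norm.
Variables (R : realType) (I : choiceType) (b : bool).
Local Notation E := (@seqspace R I b).
Implicit Types (F D : {fset I}) (u v w : E).

Lemma coordfD u v : coordf (u + v) = coordf u + coordf v. Proof. by []. Qed.
Lemma coordfZ c u : coordf (c *: u) = c *: coordf u. Proof. by []. Qed.
Lemma coordfB u v : coordf (u - v) = coordf u - coordf v. Proof. by []. Qed.

Lemma seqspace_vanishing v : vanishing b v.
Proof. by case: v => f fE; exact/asboolP. Qed.

Definition seqnorm v : R :=
  sup [set Num.sqrt (sumsq F v) | F in [set F | admissible b F]].

Lemma sumsq_le_seqnorm F v : admissible b F -> sumsq F v <= seqnorm v ^+ 2.
Proof.
move=> Fb; have [M MP] := vanishing_bounded (seqspace_vanishing v).
have leF : Num.sqrt (sumsq F v) <= seqnorm v.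
  apply: ub_le_sup; last by exists F.
  by exists (Num.sqrt M) => _ [G Gb <-]; rewrite ler_wsqrtr ?MP.
rewrite -(sqr_sqrtr (sumsq_ge0 F v)) ler_sqr ?nnegrE ?sqrtr_ge0//.
exact: le_trans (sqrtr_ge0 _) leF.
Qed.

Lemma seqnorm_le M v : 0 <= M ->
  (forall F, admissible b F -> sumsq F v <= M ^+ 2) -> seqnorm v <= M.
Proof.
move=> M0 vM; apply: ge_sup.
  by exists (Num.sqrt (sumsq fset0 v)), fset0 => //=; rewrite /admissible cardfs0 orbT.
move=> _ [F Fb <-]; rewrite -(ger0_norm M0) -sqrtr_sqr ler_wsqrtr//; exact: vM.
Qed.

Lemma seqnorm_ge0 v : 0 <= seqnorm v.
Proof.
have Fb : admissible b (fset0 : {fset I}) by rewrite /admissible cardfs0 orbT.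
have [M MP] := vanishing_bounded (seqspace_vanishing v).
apply: le_trans (sqrtr_ge0 (sumsq fset0 v)) _.
apply: ub_le_sup; last by exists fset0.
by exists (Num.sqrt M) => _ [G Gb <-]; rewrite ler_wsqrtr ?MP.
Qed.

Lemma ler_seqnormD u v : seqnorm (u + v) <= seqnorm u + seqnorm v.
Proof.
have u0 := seqnorm_ge0 u; have v0 := seqnorm_ge0 v.
apply: seqnorm_le => [|F Fb]; first exact: addr_ge0.
have Fu := sumsq_le_seqnorm u Fb; have Fv := sumsq_le_seqnorm v Fb.
rewrite coordfD sumsqD sqrrD -[_ * _ *+ 2]mulr_natl.
rewrite lerD// lerD// ler_pM2l//.
(* Only the cross term is left; Cauchy-Schwarz bounds it after squaring. *)
apply: le_trans (ler_norm _) _.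
rewrite -(ger0_norm (mulr_ge0 u0 v0)) -ler_sqr ?nnegrE// ?real_normK ?num_real//.
rewrite exprMn; apply: le_trans (cauchy_schwarz _ _ _) _.
by rewrite ler_pM ?sumsq_ge0.
Qed.

Lemma seqnormZ c v : seqnorm (c *: v) = `|c| * seqnorm v.
Proof.
have le d w : seqnorm (d *: w) <= `|d| * seqnorm w.
  apply: seqnorm_le => [|F Fb]; first by rewrite mulr_ge0 ?seqnorm_ge0.
  by rewrite coordfZ sumsqZ exprMn real_normK ?num_real// ler_wpM2l ?sqr_ge0 ?sumsq_le_seqnorm.
apply/eqP; rewrite eq_le le/=.
have [->|c0] := eqVneq c 0; first by rewrite normr0 mul0r seqnorm_ge0.
(* The reverse inequality is [le] for the scalar [c^-1] and the vector [c v]. *)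
have := le c^-1 (c *: v); rewrite scalerA mulVf// scale1r normfV.
by rewrite ler_pdivlMl ?normr_gt0.
Qed.

Lemma le_coord_seqnorm v a : `|v a| <= seqnorm v.
Proof.
rewrite -ler_sqr ?nnegrE ?seqnorm_ge0// real_normK ?num_real// -sumsq1.
exact/sumsq_le_seqnorm/admissible1.
Qed.

Lemma seqnorm_eq0 v : seqnorm v = 0 -> v = 0.
Proof.
move=> v0; apply/val_inj/funext => a; apply/eqP.
by rewrite -normr_le0 -v0 le_coord_seqnorm.
Qed.

HB.instance Definition _ :=
  Lmodule_isNormed.Build R E ler_seqnormD seqnormZ seqnorm_eq0.

Lemma sumsq_le_norm F v : admissible b F -> sumsq F v <= `|v| ^+ 2.
Proof. exact: sumsq_le_seqnorm. Qed.

Lemma norm_le_sumsq M v : 0 <= M ->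
  (forall F, admissible b F -> sumsq F v <= M ^+ 2) -> `|v| <= M.
Proof. exact: seqnorm_le. Qed.

Lemma le_coord_norm v a : `|v a| <= `|v|.
Proof. exact: le_coord_seqnorm. Qed.

Lemma coord_cvg (G : set_system E) v a : Filter G -> G --> v ->
  (fun w : E => w a) @ G --> v a.
Proof.
move=> GF /cvgrPdist_le Gv; apply/cvgrPdist_le => eps eps0.
near=> w; apply: le_trans (le_coord_norm (v - w) a) _.
by near: w; exact: Gv.
Unshelve. all: by end_near. Qed.

(** The candidate limit is the coordinatewise limit [l]. Cauchy estimates on a fixed admissible set
    pass to the limit with a bound independent of that set, which yields both that [l] is vanishing
    and that the convergence is in norm. *)
Lemma seqspace_complete (G : set_system E) : ProperFilter G -> cauchy G -> cvg G.
Proof.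
move=> GF Gc.
have coordc a : cvg ((fun w : E => w a) @ G).
  apply: cauchy_cvg; apply/cauchy_ballP => eps eps0.
  move/cauchy_ballP: Gc => /(_ _ eps0).
  rewrite !near_simpl => Gc.
  rewrite near_map2; apply: filterS Gc => -[x y].
  rewrite -!ball_normE/=; apply: le_lt_trans.
  exact: (le_coord_norm (x - y)).
pose l a : R := lim ((fun w : E => w a) @ G).
have lP a : (fun w : E => w a) @ G --> l a by exact: coordc.
have near_l (eps : R) : 0 < eps -> exists w : E, (\forall v \near G, `|w - v| <= eps) /\
    forall F, admissible b F -> sumsq F (coordf w - l) <= eps ^+ 2.
  move=> eps0; have /cauchyP/(_ _ eps0)[w Gw] := Gc.
  have Gw' : \forall v \near G, `|w - v| <= eps.
    by apply: filterS Gw => v; rewrite -ball_normE/=; exact: ltW.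
  exists w; split=> // F Fb.
  have cw : (fun v : E => sumsq F (coordf w - coordf v)) @ G --> sumsq F (coordf w - l).
    by apply: sumsq_cvg => a; apply: cvgB; [exact: cvg_cst|exact: lP].
  apply: (@closed_cvg _ _ _ _ _ _ (@closed_le R (eps ^+ 2)) _ _ cw).
  apply: filterS Gw' => v wv.
  apply: le_trans (sumsq_le_norm (w - v) Fb) _.
  by rewrite ler_sqr ?nnegrE ?(ltW eps0).
have lE : vanishing b l.
  move=> eps eps0.
  (* With [l = (l - w) + w], [sumsqD_le] turns two bounds by [eps / 4] into [eps]. *)
  have e0 : 0 < Num.sqrt (eps / 4) by rewrite sqrtr_gt0; lra.
  have [w [_ wl]] := near_l _ e0.
  have [D DP] := seqspace_vanishing w (divr_gt0 eps0 (ltr0n _ 4)).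
  exists D => F Fb FD.
  have -> : l = (l - coordf w) + coordf w by rewrite subrK.
  apply: le_trans (sumsqD_le _ _ _) _; rewrite sumsqB.
  have := wl _ Fb; have := DP _ Fb FD; rewrite sqr_sqrtr; lra.
pose L : E := SeqSpace (introT (asboolP _) lE).
apply/cvg_ex; exists L; apply/cvgrPdist_le => eps eps0.
have [w [wv wl]] := near_l _ (divr_gt0 eps0 (ltr0n _ 2)).
apply: filterS wv => v wv.
rewrite -[L - v](subrKA w) (le_trans (ler_normD _ _))// [eps]splitr lerD//.
by rewrite distrC; apply: norm_le_sumsq => //; lra.
Qed.

HB.instance Definition _ := Uniform_isComplete.Build E seqspace_complete.

End Norm.

(* The inner product in the Hilbert case *)
#[local] Existing Instance totally_filter.

Section InnerProduct.
Variables (R : realType) (I : choiceType).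
Local Notation E := (@seqspace R I true).
Implicit Types (u v w : E).

(** As [I] may be uncountable, the sum is unordered: a limit along the finite subsets directed by
    inclusion. *)
Definition inner u v : R := lim ((fun F : {fset I} => \sum_(a <- F) u a * v a) @ totally).

Lemma sumsq_cvg_norm v : (fun F : {fset I} => sumsq F v) @ totally --> `|v| ^+ 2.
Proof.
apply/cvgrPdist_le => eps eps0.
suff [D DP] : exists D, `|v| ^+ 2 <= sumsq D v + eps.
  exists D => // F /= DF; rewrite ger0_norm ?subr_ge0 ?sumsq_le_norm//.
  by rewrite lerBlDl (le_trans DP)// lerD2r sumsq_sub.
(* Otherwise all finite sums are at most [|v|^2 - eps], whose square root would then bound the norm
   of [v]. *)
apply: contrapT => /forallNP vP.
have lt F : sumsq F v <= `|v| ^+ 2 - eps.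
  by rewrite lerBrDr ltW// ltNge; apply/negP.
have n0 : 0 <= `|v| ^+ 2 - eps by exact: le_trans (sumsq_ge0 fset0 v) (lt _).
have : `|v| <= Num.sqrt (`|v| ^+ 2 - eps).
  by apply: norm_le_sumsq => // F _; rewrite sqr_sqrtr.
rewrite -ler_sqr ?nnegrE// sqr_sqrtr//; lra.
Qed.

(** Polarization expresses the partial sums through the sums of squares of [u + v] and [u - v],
    which converge. *)
Lemma inner_cvg u v : (fun F : {fset I} => \sum_(a <- F) u a * v a) @ totally --> inner u v.
Proof.
suff : cvg ((fun F : {fset I} => \sum_(a <- F) u a * v a) @ @totally I) by [].
apply/cvg_ex; exists (4^-1 * (`|u + v| ^+ 2 - `|u - v| ^+ 2)).
rewrite [X in X @ _](_ : _ =
    (fun F => 4^-1 * (sumsq F (u + v : E) - sumsq F (u - v : E)))); last first.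
  apply/funext => F; rewrite coordfD coordfB -[- coordf v]scaleN1r !sumsqD sumsqZ.
  have -> : \sum_(a <- F) u a * (- 1 *: coordf v) a = - \sum_(a <- F) u a * v a.
    by rewrite -sumrN; apply: eq_bigr => a _; rewrite -[(_ *: _) a]/(- 1 * v a); ring.
  by field.
apply: cvgM; first exact: cvg_cst.
by apply: cvgB; exact: sumsq_cvg_norm.
Qed.

Lemma inner_product_for_inner : inner_product_for inner.
Proof.
split=> [u v|c u v w|v].
- rewrite /inner (_ : (fun F : {fset I} => \sum_(a <- F) u a * v a) =
      (fun F : {fset I} => \sum_(a <- F) v a * u a))//.
  by apply/funext => F; apply: eq_bigr => a _; rewrite mulrC.
- rewrite /inner; apply: cvg_lim; first exact: Rhausdorff.
  rewrite [X in X @ _](_ : _ =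
      (fun F : {fset I} => c * (\sum_(a <- F) u a * w a) + \sum_(a <- F) v a * w a)); last first.
    apply/funext => F; rewrite mulr_sumr -big_split; apply: eq_bigr => a _ /=.
    by rewrite -[X in X * _]/(c * u a + v a); ring.
  by apply: cvgD; [apply: cvgM; [exact: cvg_cst|]|]; exact: inner_cvg.
- by apply/esym/cvg_lim; [exact: Rhausdorff|exact: sumsq_cvg_norm].
Qed.

End InnerProduct.

(** * Continuous functionals and the weak topology *)

Section Functional.
Variables (R : realType) (V : normedModType R) (phi : V -> R).
Hypotheses (phil : lin_functional phi) (phic : continuous phi).

Lemma lin_functional0 : phi 0 = 0.
Proof. by have := phil 1 0 0; rewrite scaler0 addr0; lra. Qed.

Lemma lin_functionalD x y : phi (x + y) = phi x + phi y.
Proof. by rewrite -[x]scale1r phil mul1r scale1r. Qed.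

Lemma lin_functionalZ c x : phi (c *: x) = c * phi x.
Proof. by rewrite -[c *: x]addr0 phil lin_functional0 addr0. Qed.

Lemma lin_functionalN x : phi (- x) = - phi x.
Proof. by rewrite -scaleN1r lin_functionalZ mulN1r. Qed.

Lemma lin_functionalB x y : phi (x - y) = phi x - phi y.
Proof. by rewrite lin_functionalD lin_functionalN. Qed.

Lemma lin_functional_bounded : exists2 C, 0 < C & forall x, `|phi x| <= C * `|x|.
Proof.
have /cvgrPdist_lt/(_ _ ltr01)/nbhs_ballP[d d0 dP] := @phic (0 : V).
have {}dP x : `|x| < d -> `|phi x| < 1.
  move=> xd; have := dP x; rewrite lin_functional0 sub0r normrN; apply.
  by rewrite -ball_normE/= sub0r normrN.
exists (2 / d) => [|x]; first exact: divr_gt0.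
have [->|x0] := eqVneq x 0; first by rewrite lin_functional0 !normr0 mulr0.
have nx : 0 < `|x| by rewrite normr_gt0.
(* Scaling by this factor gives [x] the norm [d / 2 < d], where [phi] is below 1 in absolute
   value. *)
have c0 : 0 < d / (2 * `|x|) by rewrite divr_gt0// mulr_gt0.
have lt1 : d / (2 * `|x|) * `|phi x| < 1.
  rewrite -{1}(gtr0_norm c0) -normrM -lin_functionalZ; apply: dP.
  rewrite normrZ gtr0_norm//.
  have -> : d / (2 * `|x|) * `|x| = d / 2 by field; rewrite gt_eqF.
  by rewrite ltr_pdivrMr// ltr_pMr// ltr1n.
have -> : 2 / d * `|x| = (d / (2 * `|x|))^-1 by field; rewrite !gt_eqF//.
by rewrite -(ler_pM2l c0) mulfV ?gt_eqF// ltW.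
Qed.

End Functional.

(** A weak neighbourhood of [e] contains a finite intersection of subbasic sets around [e], and a
    filter is closed under finite intersections. *)
Lemma weak_cvg (R : realType) (V : normedModType R) (T : Type) (G : set_system T) (h : T -> V) (e : V) :
  Filter G ->
  (forall phi, lin_functional phi -> continuous phi -> phi \o h @ G --> phi e) ->
  (h : T -> weak_topology V) @ G --> (e : weak_topology V).
Proof.
move=> GF hphi; move=> A; rewrite /= nbhsE => -[B [[C Csub <-] [D CD De]] BA].
have := Csub _ CD => -[F Fsub FD].
suff : (h @ G) D by apply: filterS => x Dx; apply: BA; exists D.
rewrite -FD; apply: filter_bigI => U UF.
have : D `<=` U by rewrite -FD => x; apply; exact: UF.
move: (Fsub _ UF); rewrite inE => -[phi [W [phil phic oW ->]]] DU.
by apply: (hphi _ phil phic); apply: open_nbhs_nbhs; split => //; exact: DU.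
Qed.

Lemma open_weak_preimage (R : realType) (V : normedModType R) (phi : V -> R) (W : set R) :
  lin_functional phi -> continuous phi -> open W ->
  open (phi @^-1` W : set (weak_topology V)).
Proof.
move=> phil phic oW; exists [set phi @^-1` W]; last by rewrite bigcup_set1.
move=> _ ->; exists [fset (phi @^-1` W)]%fset.
  by move=> A; rewrite in_fset1 => /eqP ->; rewrite inE; exists phi, W.
rewrite predeqE => x; split=> [|Wx A /=]; last by rewrite in_fset1 => /eqP ->.
by move=> /(_ (phi @^-1` W)); apply; rewrite /= in_fset1.
Qed.

(** * On bounded sets, coordinatewise convergence implies weak convergence *)

Section BoundedPointwise.
Variables (R : realType) (I : choiceType) (b : bool).
Local Notation E := (@seqspace R I b).
Implicit Types (F D : {fset I}) (u v w : E).

Definition cut (D : {fset I}) (f : I -> R) a := if a \in D then f a else 0.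

Lemma vanishing_cut D (f : I -> R) : cut D f \in vanishing_pred b.
Proof.
apply/asboolP => eps eps0; exists D => F _ /fdisjointP FD.
by rewrite sumsq_eq0 ?ltW// => a /FD; rewrite /cut => /negbTE ->.
Qed.

Definition restr D u : E := SeqSpace (vanishing_cut D u).

Lemma restrE D u a : restr D u a = if a \in D then u a else 0.
Proof. by []. Qed.

Lemma sumsq_restr F D u : sumsq F (restr D u) = sumsq (F `&` D)%fset u.
Proof.
rewrite (sumsq_split D) [X in _ + X]sumsq_eq0 ?addr0.
  rewrite /sumsq big_seq [RHS]big_seq; apply: eq_bigr => a.
  by rewrite restrE inE => /andP[_ ->].
by move=> a; rewrite restrE inE => /andP[/negbTE ->].
Qed.

Lemma sumsq_subr_restr F D u : sumsq F (u - restr D u : E) = sumsq (F `\` D)%fset u.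
Proof.
rewrite coordfB (sumsq_split D) [X in X + _]sumsq_eq0 ?add0r.
  rewrite /sumsq big_seq [RHS]big_seq; apply: eq_bigr => a.
  rewrite -[(_ - _) a]/(u a - restr D u a) restrE inE => /andP[/negbTE -> _].
  by rewrite subr0.
move=> a; rewrite -[(_ - _) a]/(u a - restr D u a) restrE inE => /andP[_ ->].
by rewrite subrr.
Qed.

Lemma norm_subr_restr D u : `|u - restr D u| <= `|u|.
Proof.
apply: norm_le_sumsq => // F Fb; rewrite sumsq_subr_restr.
exact/sumsq_le_norm/(admissible_sub _ Fb)/fsubsetDl.
Qed.

(** Truncation to the set [D] supplied by [vanishing] leaves only a small tail, so finitely
    supported vectors are norm dense. *)
Lemma restr_approx u (eps : R) : 0 < eps -> exists D, `|u - restr D u| <= eps.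
Proof.
move=> eps0; have [D DP] := seqspace_vanishing u (exprn_gt0 2 eps0).
exists D; apply: norm_le_sumsq => [|F Fb]; first exact: ltW.
rewrite sumsq_subr_restr; apply: DP; last exact: fdisjoint_fsetD.
exact: admissible_sub (fsubsetDl _ _) Fb.
Qed.

(* Sliding hump: otherwise one could sum [n] disjointly supported vectors of
   norm at most 1, each with [phi > eps / 2]; the sum has norm at most [sqrt n]
   while [phi] grows linearly. *)
Lemma lin_functional_small_outside (phi : E -> R) (eps : R) :
  lin_functional phi -> continuous phi -> 0 < eps ->
  exists D, forall u, `|u| <= 1 -> (forall a, a \in D -> u a = 0) -> `|phi u| <= eps.
Proof.
move=> phil phic eps0; have [C C0 phiC] := lin_functional_bounded phil phic.
apply: contrapT => /forallNP noD.
have bad D : exists u, [/\ `|u| <= 1, forall a, a \in D -> u a = 0 & eps < phi u].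
  have /existsNP[u /not_implyP[u1 /not_implyP[u0 /negP]]] := noD D.
  rewrite -ltNge lter_normr => /orP[epsu|epsu]; first by exists u.
  exists (- u); split; rewrite ?normrN ?(lin_functionalN phil)// => a aD.
  by rewrite -[LHS]/(- u a) u0 ?oppr0.
have hump n : exists D (s : E), [/\ forall a, a \notin D -> s a = 0,
    forall F, admissible b F -> sumsq F s <= n%:R & n%:R * (eps / 2) <= phi s].
  elim: n => [|n [D [s [s0 sn phis]]]].
    exists fset0, 0; split=> //; last by rewrite (lin_functional0 phil) mul0r.
    by move=> F _; rewrite sumsq_eq0.
  have [u [u1 u0 phiu]] := bad D.
  (* Truncating [u] with this error changes [phi] by at most [eps / 2], so the new hump still
     contributes [eps / 2] and has finite support. *)
  have e0 : 0 < eps / (2 * C) by rewrite divr_gt0// mulr_gt0.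
  have [D' D'P] := restr_approx u e0.
  exists (D `|` D')%fset, (s + restr D' u); split.
  - move=> a; rewrite inE negb_or => /andP[aD /negbTE aD'].
    by rewrite -[LHS]/(s a + restr D' u a) s0// restrE aD' addr0.
  (* [s] vanishes off [D] and [u] on [D], so the cross term is zero and the sums of squares add. *)
  - move=> F Fb; rewrite coordfD sumsqD big1 ?mulr0 ?addr0.
            rewrite -natr1 lerD ?sn// sumsq_restr.
      apply: le_trans (sumsq_le_norm u (admissible_sub (fsubsetIl _ _) Fb)) _.
      by rewrite exprn_ile1.
    move=> a _; rewrite restrE; case: (boolP (a \in D)) => [/u0 ->|/s0 ->].
      by rewrite if_same mulr0.
    by rewrite mul0r.
  - rewrite (lin_functionalD phil) -natr1 mulrDl lerD// mul1r.
    have := le_trans (phiC (u - restr D' u)) (ler_wpM2l (ltW C0) D'P).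
    have -> : C * (eps / (2 * C)) = eps / 2 by field; rewrite gt_eqF.
    rewrite (lin_functionalB phil) ler_norml => /andP[_]; lra.
(* Square [n eps / 2 <= phi s <= C sqrt n] and divide by [n]. *)
have bound n : n%:R * eps ^+ 2 <= 4 * C ^+ 2.
  have [D [s [_ sn phis]]] := hump n.
  have ns : `|s| <= Num.sqrt n%:R.
    by apply: norm_le_sumsq => [|F Fb]; rewrite ?sqr_sqrtr ?sn.
  have phin : n%:R * (eps / 2) <= C * Num.sqrt n%:R.
    apply: le_trans phis (le_trans (ler_norm _) (le_trans (phiC s) _)).
    by rewrite ler_pM2l.
  have [->|n0] := eqVneq (n%:R : R) 0.
    by rewrite mul0r mulr_ge0// sqr_ge0.
  have {}n0 : 0 < n%:R :> R by rewrite lt_neqAle eq_sym n0 ler0n.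
  have : (n%:R * (eps / 2)) ^+ 2 <= (C * Num.sqrt n%:R) ^+ 2.
    by rewrite ler_sqr ?nnegrE// mulr_ge0 ?sqrtr_ge0 ?divr_ge0 ?ltW.
  rewrite [X in _ <= X]exprMn sqr_sqrtr ?ler0n//.
  have -> : (n%:R * (eps / 2)) ^+ 2 = n%:R * (n%:R * eps ^+ 2 / 4) :> R by field.
  by rewrite [C ^+ 2 * _]mulrC ler_pM2l// ler_pdivrMr// [C ^+ 2 * _]mulrC.
have e2 : 0 < eps ^+ 2 by rewrite exprn_gt0.
have x0 : 0 <= 4 * C ^+ 2 / eps ^+ 2.
  by rewrite divr_ge0 ?(ltW e2)// mulr_ge0 ?sqr_ge0.
have := bound (Num.bound (4 * C ^+ 2 / eps ^+ 2)).
by rewrite -ler_pdivlMr// leNgt archi_boundP.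
Qed.

(** Split [e - h t] at a finite set [D]: coordinatewise convergence makes the part on [D] small in
    norm, and off [D] the functional is uniformly small on bounded sets. *)
Lemma bounded_pointwise_weak_cvg (T : Type) (G : set_system T) (h : T -> E) (e : E)
    (M : R) : Filter G ->
  (\forall t \near G, `|h t| <= M) -> (forall a, (fun t => h t a) @ G --> e a) ->
  (h : T -> weak_topology E) @ G --> (e : weak_topology E).
Proof.
move=> GF hM he; apply: weak_cvg => phi phil phic.
have [C C0 phiC] := lin_functional_bounded phil phic.
apply/cvgrPdist_le => eps eps0.
(* [N] bounds the norm of [e - h t]; the [+ 1] makes it positive, so that dividing by [N] brings the
   part off [D] into the unit ball. *)
pose N : R := `|M| + `|e| + 1.
have N0 : 0 < N by rewrite ltr_wpDl// addr_ge0.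
have [D DP] := lin_functional_small_outside phil phic (divr_gt0 eps0 (mulr_gt0 (ltr0n _ 2) N0)).
have d0 : 0 < eps / (2 * C) by rewrite divr_gt0// mulr_gt0.
have : (fun t => sumsq D (coordf (e - h t))) @ G --> sumsq D (fun=> 0 : R).
  apply: sumsq_cvg => a; rewrite -(subrr (e a)).
  by apply: cvgB; [exact: cvg_cst|exact: he].
rewrite [sumsq D (fun=> 0)]sumsq_eq0// => /cvgrPdist_le/(_ _ (exprn_gt0 2 d0)).
apply: filterS2 hM => t ht; rewrite sub0r normrN ger0_norm ?sumsq_ge0// => hD.
pose u := e - h t.
have uN : `|u| <= N.
  apply: le_trans (ler_normB _ _) _.
  have M_le : M <= `|M| by exact: ler_norm.
  have := le_trans ht M_le; rewrite /N; lra.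
have -> : phi e - (phi \o h) t = phi (restr D u) + phi (u - restr D u).
  by rewrite -(lin_functionalD phil) [X in _ = phi X]addrC subrK (lin_functionalB phil).
rewrite (le_trans (ler_normD _ _))// [eps]splitr lerD//.
  have rD : `|restr D u| <= eps / (2 * C).
    apply: norm_le_sumsq => [|F Fb]; first exact: ltW.
    by rewrite sumsq_restr (le_trans (sumsq_sub _ (fsubsetIr _ _))).
  apply: le_trans (phiC _) (le_trans (ler_wpM2l (ltW C0) rD) _).
  by rewrite le_eqVlt; apply/orP; left; apply/eqP; field; rewrite gt_eqF.
have := DP (N^-1 *: (u - restr D u)).
rewrite (lin_functionalZ phil) normrZ normrM gtr0_norm ?invr_gt0//.
rewrite ler_pdivrMl// mulr1 => /(_ (le_trans (norm_subr_restr _ _) uN)).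
move=> /(_ _); rewrite ler_pdivrMl//.
have -> : N * (eps / (2 * N)) = eps / 2 by field; rewrite gt_eqF.
apply=> a aD.
by rewrite -[LHS]/(N^-1 * (u a - restr D u a)) restrE aD subrr mulr0.
Qed.

End BoundedPointwise.

(** * Geometric bounds and the compact set of adequate functions *)

Lemma sum_half_pow_le (R : realFieldType) (I : choiceType) (F : {fset I}) (lev : I -> nat) N :
  {in F &, injective lev} -> (forall a, a \in F -> (N <= lev a)%N) ->
  \sum_(a <- F) (2^-1 : R) ^+ lev a <= 2 * 2^-1 ^+ N.
Proof.
move=> inj leN; set s := [seq lev a | a <- F].
have us : uniq s by rewrite map_inj_in_uniq ?fset_uniq.
(* [M] exceeds every level; adding [N] ensures [N <= M] even when [F] is empty. *)
pose M := (N + (\max_(n <- s) n).+1)%N.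
have sM n : n \in s -> (N <= n < M)%N.
  move=> ns; have /mapP[a aF ->] := ns; rewrite leN//= /M addnS ltnS.
  by rewrite (leq_trans _ (leq_addl _ _))// (leq_bigmax_seq (F := id))// map_f.
have -> : \sum_(a <- F) (2^-1 : R) ^+ lev a = \sum_(n <- s) 2^-1 ^+ n.
  by rewrite big_map.
have -> : \sum_(n <- s) (2^-1 : R) ^+ n = \sum_(N <= n < M | n \in s) 2^-1 ^+ n.
  rewrite -[RHS]big_filter; apply/perm_big/uniq_perm => // [|n].
    exact/filter_uniq/iota_uniq.
  rewrite mem_filter mem_index_iota.
  by case: (boolP (n \in s)) => // /sM ->.
apply: (@le_trans _ _ (\sum_(N <= n < M) (2^-1 : R) ^+ n)).
  rewrite [leLHS]big_mkcond ler_sum// => n _; case: ifP => _; first exact: lexx.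
  by rewrite exprn_ge0// invr_ge0.
(* [2^-n] is the increment of [-2 * 2^-n], so the sum telescopes. *)
have -> : \sum_(N <= n < M) (2^-1 : R) ^+ n =
    \sum_(N <= n < M) (- 2 * 2^-1 ^+ n.+1 - - 2 * 2^-1 ^+ n).
  by apply: eq_bigr => n _; rewrite exprS; field.
rewrite telescope_sumr ?leq_addr//.
have : 0 <= (2^-1 : R) ^+ M by rewrite exprn_ge0// invr_ge0.
lra.
Qed.

Section Embedding.
Variables (R : realType) (X : topologicalType) (b : bool).
Variables (B : set (set X)) (G : nat -> set (set X)).
Hypothesis BG : B = \bigcup_n G n.
Hypothesis spf : forall n, strongly_point_finite (G n).
Hypothesis disj : b -> forall n, disjoint_family (G n).
Variable lev : set X -> nat.
Hypothesis levP : forall A, B A -> G (lev A) A.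

Local Notation E := (@seqspace R (set X) b).

(** Coordinates are indexed by all subsets of [X], which avoids a subtype; weight 0 kills those
    outside [B]. *)
Definition weight (A : set X) : R := if `[< B A >] then 2^-1 ^+ lev A else 0.

(** Each condition restricts only finitely many coordinates, which makes the set closed in the
    product. *)
Definition adequate : set (set X -> R) := [set v | (forall A, 0 <= v A <= weight A) /\
  forall n S, S `<=` G n -> finite_set S -> \bigcap_(A in S) A = set0 ->
    exists2 A, S A & v A = 0].

Lemma adequate_support v A : adequate v -> v A != 0 -> B A.
Proof.
move=> [vw _]; apply: contraNP => nBA; have := vw A.
by rewrite /weight asboolF// => /andP[v0 v1]; rewrite eq_le v1.
Qed.

Lemma adequate_sqr_le v A : adequate v -> v A ^+ 2 <= 2^-1 ^+ lev A.
Proof.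
move=> [vw _]; have /andP[v0 vA] := vw A.
have w1 : weight A <= 2^-1 ^+ lev A.
  by rewrite /weight; case: ifP => // _; rewrite exprn_ge0// invr_ge0.
have l1 : (2^-1 : R) ^+ lev A <= 1 by rewrite exprn_ile1// ?invr_ge0// invf_le1// ler1n.
have v1 := le_trans vA w1; nra.
Qed.

(** If [b] holds, two distinct members of one level form a finite subfamily with empty intersection,
    so one of their coordinates is 0. Otherwise [F] has at most one element. *)
Lemma adequate_lev_inj v (F : {fset set X}) : adequate v -> admissible b F ->
  {in [fset A in F | v A != 0]%fset &, injective lev}.
Proof.
move=> vC /orP[b1|F1] A A'; rewrite !inE => /andP[AF vA] /andP[A'F vA'] AA'.
  apply: contrapT => nAA'.
  have GA := levP (adequate_support vC vA); have GA' := levP (adequate_support vC vA').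
  rewrite -AA' in GA'.
  have [|||C [->|->]] := vC.2 (lev A) [set A; A'].
  - by move=> _ [->|->].
  - exact: finite_set2.
  - by rewrite bigcap_setU !bigcap_set1; exact: (disj b1 GA GA' nAA').
  - by move/eqP: vA.
  - by move/eqP: vA'.
apply/eqP; apply: contraTT F1 => AA'n; rewrite -ltnNge.
have : ([fset A; A'] `<=` F)%fset by rewrite fsubUset !fsub1set AF.
by move/fsubset_leq_card; rewrite cardfs2 AA'n.
Qed.

(** The nonzero coordinates on [F] have distinct levels, so a geometric series dominates their
    squares, uniformly in [v]. *)
Lemma adequate_sumsq v (F : {fset set X}) N : adequate v -> admissible b F ->
  (forall A, A \in F -> v A != 0 -> (N <= lev A)%N) ->
  sumsq F v <= 2 * 2^-1 ^+ N.
Proof.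
move=> vC Fb FN; pose F' := [fset A in F | v A != 0]%fset.
have -> : sumsq F v = sumsq F' v.
  rewrite (sumsq_split F') [X in _ + X]sumsq_eq0 ?addr0.
    by rewrite (fsetIidPr _)//; apply/fsubsetP => A; rewrite !inE => /andP[].
  by move=> A; rewrite !inE => /andP[/[swap] ->]; rewrite /= negbK => /eqP.
apply: (@le_trans _ _ (\sum_(A <- F') (2^-1 : R) ^+ lev A)).
  by rewrite /sumsq ler_sum// => A _; exact: adequate_sqr_le.
apply: sum_half_pow_le => [|A]; first exact: adequate_lev_inj.
by rewrite !inE => /andP[]; exact: FN.
Qed.

(** An infinite support would contain a countably infinite subfamily of [G n]. Strong
    point-finiteness gives it a finite subfamily with empty intersection, on which [v] has a
    zero. *)
Lemma adequate_finite_level v n : adequate v -> finite_set [set A | G n A /\ v A != 0].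
Proof.
move=> vC; apply: contrapT => /infiniteP/pcard_leP[g].
have SG := fun_image_sub g; have Sn := card_image g; set S := g @` _ in SG Sn.
have [|||S' [S'fin S'S S'0]] := spf (n := n) (S := S).
- by move=> A /SG[].
- by rewrite (eq_countable Sn).
- by apply/infiniteP; rewrite (card_le_eqr Sn).
have [A S'A vA] : exists2 A, S' A & v A = 0.
  by apply: (vC.2 n) => // A /S'S/SG[].
by have [_] := SG _ (S'S _ S'A); rewrite vA eqxx.
Qed.

Lemma adequate_vanishing v : adequate v -> vanishing b v.
Proof.
move=> vC eps eps0.
have [N Neps] : exists N, 2 * 2^-1 ^+ N <= eps.
  have : (2 * 2^-1 ^+ n : R) @[n --> \oo] --> (0 : R).
    rewrite -[X in _ --> X](mulr0 2); apply: cvgM; first exact: cvg_cst.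
    by apply: cvg_expr; rewrite ger0_norm ?invr_ge0// invf_lt1// ltr1n.
  move=> /cvgrPdist_le/(_ _ eps0)[N _ NP]; exists N.
  by have := NP N (leqnn N); rewrite sub0r normrN; exact/le_trans/ler_norm.
(* Collect the supports on the levels below [N]: off this finite set, nonzero coordinates have level
   at least [N]. *)
have Dfin : finite_set (\bigcup_(n in `I_N) [set A | G n A /\ v A != 0]).
  by apply: bigcup_finite => // n _; exact: adequate_finite_level.
exists (fset_set (\bigcup_(n in `I_N) [set A | G n A /\ v A != 0])) => F Fb /fdisjointP FD.
apply: le_trans (adequate_sumsq (N := N) vC Fb _) Neps => A AF vA.
rewrite leqNgt; apply: contra (FD _ AF) => AN.
rewrite in_fset_set// inE; exists (lev A) => //=; split=> //.
exact/levP/(adequate_support vC).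
Qed.

Lemma closed_adequate : closed (adequate : set {ptws set X -> R}).
Proof.
(* As [S] is finite, having a zero coordinate in [S] is a finite union of closed conditions. *)
have -> : (adequate : set {ptws set X -> R}) =
    (\bigcap_A (@proj _ (fun=> R) A @^-1` `[0, weight A])) `&`
    \bigcap_(nS in [set nS : nat * set (set X) |
       [/\ nS.2 `<=` G nS.1, finite_set nS.2 & \bigcap_(A in nS.2) A = set0]])
      \bigcup_(A in nS.2) (@proj _ (fun=> R) A @^-1` [set 0]).
  apply/seteqP; split=> v /=.
    move=> [vw v0]; split=> [A _ /=|[n S] [/= SG Sf S0]]; first by rewrite in_itv/=; exact: vw.
    by have [A SA vA] := v0 _ _ SG Sf S0; exists A.
  move=> [vw v0]; split=> [A|n S SG Sf S0].
    by have := vw A I; rewrite /= in_itv/=.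
  by have [A SA vA] := v0 (n, S) (And3 SG Sf S0); exists A.
have projc A : continuous (@proj _ (fun=> R) A : {ptws set X -> R} -> R).
  exact: proj_continuous.
apply: closedI; first apply: closed_bigI => A _.
  by apply: preimage_closed; [exact: in1W|exact: interval_closed].
apply: closed_bigI => -[n S] [/= _ Sf _]; apply: closed_bigcup => // A _.
by apply: preimage_closed; [exact: in1W|exact: closed_eq].
Qed.

Lemma compact_adequate : compact (adequate : set {ptws set X -> R}).
Proof.
apply: (@subclosed_compact _ _ [set v : {ptws set X -> R} | forall A, `[0, weight A]%classic (v A)]).
- exact: closed_adequate.
- exact: (@tychonoff (set X) (fun=> R) (fun A => `[0, weight A]%classic)
    (fun A => @segment_compact R 0 (weight A))).
- by move=> v [vw _] A; rewrite /= in_itv/= vw.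
Qed.

(** The value 0 is a default, never taken on account of a failed test when [v] is adequate. *)
Definition seq_of (v : set X -> R) : E :=
  if pselect (vanishing b v) is left h then SeqSpace (introT (asboolP _) h) else 0.

Lemma seq_ofE v : adequate v -> coordf (seq_of v) = v.
Proof. by move=> /adequate_vanishing vE; rewrite /seq_of; case: pselect. Qed.

Lemma norm_seq_of v : adequate v -> `|seq_of v| <= 2.
Proof.
move=> vC; apply: norm_le_sumsq => // F Fb; rewrite seq_ofE//.
(* [N = 0] bounds the sum of squares by 2, hence by [2^2]. *)
apply: le_trans (adequate_sumsq (N := 0) vC Fb _) _ => //.
by rewrite expr0 mulr1 expr2 ler_pMr// ler1n.
Qed.

(** Images of adequate functions have norm at most 2, so coordinatewise convergence suffices. This
    serves both the compactness of [Kset] and the continuity of [embed]. *)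
Lemma seq_of_weak_cvg (T : Type) (H : set_system T) (h : T -> set X -> R) (v : set X -> R) :
  Filter H -> (\forall t \near H, adequate (h t)) -> adequate v ->
  (forall A, (fun t => h t A) @ H --> v A) ->
  (fun t => seq_of (h t) : weak_topology E) @ H --> (seq_of v : weak_topology E).
Proof.
move=> HF hC vC hv; apply: (bounded_pointwise_weak_cvg (M := 2)).
  by apply: filterS hC => t; exact: norm_seq_of.
move=> A; rewrite seq_ofE//; apply: cvg_trans (hv A).
apply: near_eq_cvg; apply: filterS hC => t ht; by rewrite seq_ofE.
Qed.

Definition Kset : set (weak_topology E) := seq_of @` adequate.

Lemma compact_Kset : compact Kset.
Proof.
apply: (@continuous_compact {ptws set X -> R} (weak_topology E));
  last exact: compact_adequate.
(* [seq_of] is controlled only on [adequate], so continuity is taken relative to that set. *)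
apply/subspace_continuousP => v vC.
apply: seq_of_weak_cvg => //; first exact: withinT.
by move=> A; apply: cvg_within_filter; exact: (@proj_continuous _ (fun=> R) A v).
Qed.

(** * Embedding the space into the compact set *)

Hypothesis Xh : hausdorff_space X.
Hypothesis Bb : basis B.
Variable f : set X -> X -> R.
Hypothesis fc : forall A, B A -> continuous (f A).
Hypothesis f01 : forall A, B A -> forall x, 0 <= f A x <= 1.
Hypothesis fA : forall A, B A -> A = ~` (f A @^-1` [set 0]).

Definition coords (x : X) (A : set X) := weight A * f A x.

(** The weight is positive on [B], so the coordinate at [A] vanishes exactly where [f A] does.
    Coordinates thus detect basic sets. *)
Lemma coords_neq0 x A : B A -> (coords x A != 0) <-> A x.
Proof.
move=> BA; rewrite /coords /weight asboolT// mulf_eq0 negb_or expf_neq0 ?invr_eq0//=.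
by rewrite [in X in _ <-> X](fA BA); split=> [/eqP|] //= /eqP.
Qed.

Lemma coords_adequate x : adequate (coords x).
Proof.
split=> [A|n S SG _ S0].
  rewrite /coords /weight; case: asboolP => [BA|_]; last by rewrite mul0r lexx.
  have /andP[f0 f1] := f01 BA x.
  have h0 : 0 <= (2^-1 : R) ^+ lev A by rewrite exprn_ge0// invr_ge0.
  by rewrite mulr_ge0//= ler_piMr.
(* Some [A] in [S] misses [x], and the coordinate at this [A] is 0. *)
have : ~ (\bigcap_(A in S) A) x by rewrite S0.
move=> /existsNP[A /not_implyP[SA nAx]]; exists A => //.
have BA : B A by rewrite BG; exists n => //; exact: SG.
by apply/eqP; apply: contra_notT nAx => /(coords_neq0 x BA).
Qed.

Definition embed (x : X) : weak_topology E := seq_of (coords x).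

Lemma coords_continuous A : continuous (coords^~ A).
Proof.
move=> x; rewrite /coords /weight; case: asboolP => [BA|_].
  by apply: cvgM; [exact: cvg_cst|exact: fc].
by under eq_fun do rewrite mul0r; exact: cvg_cst.
Qed.

Lemma basis_open_mem (U : set X) x : open U -> U x -> exists A, [/\ B A, A x & A `<=` U].
Proof.
move=> oU Ux; have [A [BA Ax] AU] := Bb.2 x U (open_nbhs_nbhs (conj oU Ux)).
by exists A.
Qed.

Lemma embedding_embed : top_embedding embed.
Proof.
split.
- move=> x y exy; apply: contrapT => /eqP xy.
  (* A basic set that contains [x] but not [y] gives a coordinate nonzero at [x] and zero at [y]. *)
  have [U [oU xU yU]] := hausdorff_accessible Xh xy.
  rewrite inE in xU; have [A [BA Ax AU]] := basis_open_mem oU xU.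
  have : coordf (embed x) A = coordf (embed y) A by rewrite exy.
  rewrite !seq_ofE; [|exact: coords_adequate..].
  move=> cxy; have /(coords_neq0 y BA) : coords y A != 0.
    by rewrite -cxy; apply/(coords_neq0 x BA).
  by move/AU; move: yU; rewrite inE.
- move=> x; apply: seq_of_weak_cvg.
  + by apply: nearW => y; exact: coords_adequate.
  + exact: coords_adequate.
  + by move=> A; exact: coords_continuous.
- move=> U oU.
  (* A point of the image with nonzero coordinate at [A] comes from a point of [A], and the basic
     sets inside [U] cover [U]. *)
  exists (\bigcup_(A in [set A | B A /\ A `<=` U]) [set e : weak_topology E | coordf e A != 0]).
  split.
    apply: bigcup_open => A _.
    apply: (@open_weak_preimage R E (fun e => coordf e A) [set r | r != 0]).
    + by [].
    + by move=> e; exact: (@coord_cvg _ _ _ (nbhs e) e A _ cvg_id).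
    + exact: open_neq.
  apply/seteqP; split=> [_ [x Ux <-]|e [[A [BA AU] /= eA] [x _ xe]]].
    split; last by exists x.
    have [A [BA Ax AU]] := basis_open_mem oU Ux.
    exists A => //=; rewrite seq_ofE; last exact: coords_adequate.
    exact/(coords_neq0 x BA).
  exists x => //; apply: AU; apply/(coords_neq0 x BA).
  by rewrite -(seq_ofE (coords_adequate x)) -/(embed x) xe.
Qed.

End Embedding.

(** * Assembly for a given base, and the two cases of the theorem *)

Lemma embeds_of_basis (R : realType) (X : topologicalType) (b : bool)
    (B : set (set X)) (G : nat -> set (set X)) :
  hausdorff_space X -> basis B -> (forall A, B A -> cozero_set R A) ->
  B = \bigcup_n G n -> (forall n, strongly_point_finite (G n)) ->
  (b -> forall n, disjoint_family (G n)) ->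
  exists (K : set (weak_topology (seqspace R (set X) b)))
         (f : X -> weak_topology (seqspace R (set X) b)),
    [/\ compact K, range f `<=` K & top_embedding f].
Proof.
move=> Xh Bb Bcz BG spf disj.
(* A set may lie in several [G n], so one index is chosen; 0 is the default outside [B]. *)
have [lev levP] : {lev : set X -> nat & forall A, B A -> G (lev A) A}.
  apply: (@choice _ _ (fun A n => B A -> G n A)) => A; rewrite BG.
  by have [[n _ GA]|nBA] := pselect ((\bigcup_n G n) A); [exists n|exists 0%N].
have [f fP] : {f : set X -> X -> R & forall A, B A ->
    [/\ continuous (f A), forall x, 0 <= f A x <= 1 & A = ~` (f A @^-1` [set 0])]}.
  apply: (@choice (set X) (X -> R) (fun A (g : X -> R) => B A ->
    [/\ continuous g, forall x, 0 <= g x <= 1 & A = ~` (g @^-1` [set 0])])) => A.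
  by have [/Bcz[g gP]|nBA] := pselect (B A); [exists g|exists (fun=> 0)].
exists (@Kset R X b B G lev), (@embed R X b B lev f); split.
- exact: compact_Kset.
- move=> _ [x _ <-]; exists (coords B lev f x) => //.
  by apply: coords_adequate => // A /fP[].
- by apply: (embedding_embed (G := G)) => // A /fP[].
Qed.

(** Any two distinct members of an infinite subfamily already have empty intersection. *)
Lemma disjoint_strongly_point_finite (T : Type) (F : set (set T)) :
  disjoint_family F -> strongly_point_finite F.
Proof.
move=> Fd S SF _ Sinf.
have [A SA] := infinite_setN0 Sinf.
have [C [SC /= CA]] := infinite_setN0 (infinite_setD Sinf (finite_set1 A)).
exists [set A; C]; split; first exact: finite_set2.
- by move=> _ [->|->].
- rewrite bigcap_setU !bigcap_set1; apply: Fd; [exact: SF|exact: SF|].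
  exact/nesym.
Qed.

Theorem theorem5p2 (R : realType) (X : topologicalType) :
  tychonoff_space R X ->
  (forall B : set (set X), basis B -> (forall A, B A -> cozero_set R A) ->
     sigma_disjoint B -> embeds_in_uniform_Eberlein R X) /\
  (forall B : set (set X), basis B -> (forall A, B A -> cozero_set R A) ->
     sigma_strongly_point_finite B -> embeds_in_Eberlein R X).
Proof.
move=> [Xh _]; split=> B Bb Bcz [G [BG GP]].
- have Gspf n : strongly_point_finite (G n) by exact: disjoint_strongly_point_finite.
  have [K [f Kf]] := embeds_of_basis Xh Bb Bcz BG Gspf (fun _ : true => GP).
  exists (seqspace R (set X) true), (@inner R (set X)), K, f.
  by case: Kf => ? ? ?; split => //; exact: inner_product_for_inner.
- have [K [f Kf]] := embeds_of_basis (b := false) Xh Bb Bcz BG GP (fun h => match notF h with end).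
  by exists (seqspace R (set X) false), K, f.
Qed.
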